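(* Let $z>0$ and let $(P_n)_{n\ge0}$ be the monic orthogonal polynomials with respect to $\langle \mathbf{u}_z,p\rangle=\int_0^\infty p(x)e^{-zx^4}\,dx$, with recurrence coefficients $a_n,b_n$. For $n\ge0$ define the operator $$\widehat L_n=-a_{n+1}A_n(x,z)\frac{d}{dx}-\left[a_{n+1}B_n(x,z)-(x-b_{n+1})\right],$$ where $A_n(x,z)=x/C_n(x,z)$, $B_n(x,z)=D_n(x,z)/C_n(x,z)$ and the polynomials $C_n,D_n$ are as defined in the context. Then, as an identity of rational functions of $x$, $$\widehat L_nP_{n+1}(x)=P_{n+2}(x),\qquad n\ge0.$$
   Context: The functional $\mathbf{u}_z$ is positive definite. The coefficients $a_n\neq0$ ($n\ge1$) and $b_n$ ($n\ge0$) are defined by $xP_n(x)=P_{n+1}(x)+b_nP_n(x)+a_nP_{n-1}(x)$, $n\ge0$, with $P_{-1}=0$, $P_0=1$. Convention: $a_k=0$ for $k\le0$ and $b_k=0$ for $k<0$. Put $R_n=a_{n+1}+b_n^2+a_n$ and $T_n=a_n(b_n+b_{n-1})$ (so $T_k=0$ for $k\le0$). For $n\ge0$, $$\begin{aligned}C_n(x,z)=\;&4z\left[a_{n+1}(T_{n+2}+T_n)+T_{n+1}(R_{n+1}+R_n)\right]\\&+4z\left[a_{n+1}(R_{n+1}+R_{n-1})+T_{n+1}(b_n+b_{n-1})\right](x-b_n)\\&+4z\left[T_{n+1}+a_{n+1}(b_{n-1}+b_{n-2})\right]\left[(x-b_{n-1})(x-b_n)-a_n\right]\\&+4za_{n+1}\Big((x-b_{n-2})\left[(x-b_{n-1})(x-b_n)-a_n\right]-a_{n-1}(x-b_n)\Big),\end{aligned}$$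 $$\begin{aligned}D_n(x,z)=\;&-(n+1)+4z\left[a_{n+1}(R_{n+1}+R_{n-1})+T_{n+1}(b_n+b_{n-1})\right]\\&+4z\left[T_{n+1}+a_{n+1}(b_{n-1}+b_{n-2})\right](x-b_{n-1})\\&+4za_{n+1}\left[(x-b_{n-2})(x-b_{n-1})-a_{n-1}\right].\end{aligned}$$ *)

(* Defs.v *)
From HB Require Import structures.
From mathcomp Require Import all_boot all_order all_algebra fraction.
From mathcomp Require Import all_classical all_reals all_analysis.

Set Implicit Arguments.
Unset Strict Implicit.
Unset Printing Implicit Defensive.

Import Order.TTheory GRing.Theory Num.Theory.

Local Open Scope classical_set_scope.
Local Open Scope ring_scope.

Notation "x %:F" := (@FracField.tofrac _ x) : ring_scope.

Section Functional.
Variable R : realType.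
Implicit Types (u : {poly R} -> R) (P : nat -> {poly R}).

Definition uz (z : R) (p : {poly R}) : R :=
  Rintegral (@lebesgue_measure R) `[0, +oo[
    (fun x : R => p.[x] * expR (- z * x ^+ 4)).

(* The last clause is the nondegeneracy [<u, P_n ^ 2> <> 0] that is part of
   the usual notion of an orthogonal sequence for a linear functional; when u
   is positive definite it holds automatically. *)
Definition monic_orthogonal u P : Prop :=
  [/\ forall n : nat, size (P n) = n.+1,
      forall n : nat, P n \is monic,
      forall m n : nat, m != n -> u (P m * P n) = 0
    & forall n : nat, u (P n ^+ 2) != 0].

(* The sequences a and b are indexed by [int] because the formulas below
   refer to indices as low as -2. *)
Definition recurrence_coefs P (a b : int -> R) : Prop :=
  P 0%N = 1 /\
  forall n : nat,
    'X * P n = P n.+1 + b n *: P n + a n *: (if n is m.+1 then P m else 0).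

Definition vanishing_convention (a b : int -> R) : Prop :=
  (forall k : int, k <= 0 -> a k = 0) /\ (forall k : int, k < 0 -> b k = 0).

End Functional.

Section Ladder.
Variables (R : realType) (a b : int -> R).

Definition Rcoef (n : int) : R := a (n + 1) + b n ^+ 2 + a n.

Definition Tcoef (n : int) : R := a n * (b n + b (n - 1)).

Local Notation Rc := Rcoef.
Local Notation Tc := Tcoef.
Local Notation Xb k := ('X - (b k)%:P).

Definition Cpoly (z : R) (n : int) : {poly R} :=
  (4 * z * (a (n + 1) * (Tc (n + 2) + Tc n)
            + Tc (n + 1) * (Rc (n + 1) + Rc n)))%:P
  + (4 * z * (a (n + 1) * (Rc (n + 1) + Rc (n - 1))
              + Tc (n + 1) * (b n + b (n - 1)))) *: Xb n
  + (4 * z * (Tc (n + 1) + a (n + 1) * (b (n - 1) + b (n - 2))))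
      *: (Xb (n - 1) * Xb n - (a n)%:P)
  + (4 * z * a (n + 1))
      *: (Xb (n - 2) * (Xb (n - 1) * Xb n - (a n)%:P)
          - a (n - 1) *: Xb n).

Definition Dpoly (z : R) (n : int) : {poly R} :=
  (- (n + 1)%:~R)%:P
  + (4 * z * (a (n + 1) * (Rc (n + 1) + Rc (n - 1))
              + Tc (n + 1) * (b n + b (n - 1))))%:P
  + (4 * z * (Tc (n + 1) + a (n + 1) * (b (n - 1) + b (n - 2))))
      *: Xb (n - 1)
  + (4 * z * a (n + 1))
      *: (Xb (n - 2) * Xb (n - 1) - (a (n - 1))%:P).

Definition Afrac (z : R) (n : int) : {fraction {poly R}} :=
  'X%:F / (Cpoly z n)%:F.

Definition Bfrac (z : R) (n : int) : {fraction {poly R}} :=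
  (Dpoly z n)%:F / (Cpoly z n)%:F.

Definition Lhat (z : R) (n : int) (f : {poly R}) : {fraction {poly R}} :=
  - ((a (n + 1))%:P%:F * Afrac z n * (f^`())%:F)
  - ((a (n + 1))%:P%:F * Bfrac z n - (Xb (n + 1))%:F) * f%:F.

End Ladder.

(* Main.v *)
(* The weight satisfies the Pearson equation [(x w)' = (1 - 4 z x^4) w], so
   [u (x p' + p) = 4 z u (x^4 p)] for every polynomial [p]. Hence the components
   of [x P_(n+1)'] along [P_0, ..., P_n] are [4 z] times those of [x^4 P_(n+1)],
   which four applications of the recurrence compute and which involve only
   [P_n, ..., P_(n-3)]. Running the recurrence downwards rewrites these in terms
   of [P_n] and [P_(n+1)], giving [x P_(n+1)' = C_n P_n - D_n P_(n+1)]. As the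
   coefficient [4 z a_(n+1)] of [x^3] in [C_n] is nonzero, dividing by [C_n]
   gives [P_n], hence [P_(n+2)]. *)
Require Import Defs.
From HB Require Import structures.
From mathcomp Require Import all_boot all_order all_algebra fraction.
From mathcomp Require Import all_classical all_reals all_analysis.
From mathcomp Require Import measurable_realfun zify ring lra.

Set Implicit Arguments.
Unset Strict Implicit.
Unset Printing Implicit Defensive.

Import Order.TTheory GRing.Theory Num.Theory.
Import numFieldNormedType.Exports.
Local Open Scope ring_scope.

(** * Integration over the half-line under an exponential bound *)

Section ExpBounded.
Local Open Scope classical_set_scope.
Variable R : realType.
Local Notation mu := (@lebesgue_measure R).

Lemma expRN_lin_cvg0 (c : R) : 0 < c -> expR (- c * x) @[x --> +oo] --> (0 : R).
Proof.
move=> c0.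
rewrite (_ : (fun x => expR (- c * x)) =
             (fun z => expR (- z)) \o (fun z => c * z)); last first.
  by apply/funext => x /=; rewrite mulNr.
apply: (@cvg_comp _ _ _ _ _ _ (pinfty_nbhs R)); last exact: cvgr_expR.
exact: gt0_cvgMry.
Qed.

Lemma is_derive_expRN_lin (c x : R) :
  is_derive x 1 (fun y : R => expR (- c * y)) (- c * expR (- c * x)).
Proof.
apply: is_derive_eq.
by rewrite !scaler1 /GRing.scale /=; ring.
Qed.

Lemma continuous_is_derive (F f : R -> R) :
  (forall x : R, is_derive x 1 F (f x)) -> continuous F.
Proof.
move=> dF x; apply: differentiable_continuous.
by apply/derivable1_diffP; apply: @ex_derive.
Qed.

(** For a nonnegative integrand the integral makes sense as an extended real before integrability is
    known. The fundamental theorem gives it a finite value, and integrability follows. *)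
Lemma ge0_FTC2y (f F : R -> R) (l : R) :
  (forall x, 0 <= x -> 0 <= f x) -> continuous f ->
  F x @[x --> +oo] --> l -> (forall x : R, is_derive x 1 F (f x)) ->
  mu.-integrable `[0, +oo[ (EFin \o f) /\
  \int[mu]_(x in `[0, +oo[) f x = l - F 0.
Proof.
move=> f0 cf Fl dF.
have cF := continuous_is_derive dF.
have wcf : {within `[0, +oo[, continuous f} by apply: continuous_subspaceT.
have key : (\int[mu]_(x in `[0%R, +oo[) (f x)%:E = l%:E - (F 0%R)%:E)%E.
  apply: ge0_continuous_FTC2y => //; last first.
  - by move=> x _; rewrite derive1E; have [_ ->] := dF x.
  - by apply: cvg_at_right_filter; exact: cF.
split; last by rewrite /Rintegral key.
apply/integrableP; split.
  by apply/measurable_EFinP/measurable_funTS; exact: continuous_measurable_fun.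
under eq_integral => x.
  by rewrite inE/= in_itv/= andbT => x0; rewrite ger0_norm ?f0//; over.
by rewrite key ltry.
Qed.

Lemma continuous_expRN_lin (c C : R) :
  continuous (fun x : R => C * expR (- c * x)).
Proof.
apply: (@continuous_is_derive _ (fun x => C * (- c * expR (- c * x)))) => x.
have := is_derive_expRN_lin c x => ?.
by apply: is_derive_eq.
Qed.

Lemma integral_expRN_lin (c C : R) : 0 < c -> 0 <= C ->
  mu.-integrable `[0, +oo[ (EFin \o (fun x : R => C * expR (- c * x))) /\
  \int[mu]_(x in `[0, +oo[) (C * expR (- c * x)) = C / c.
Proof.
move=> c0 C0.
have [] := @ge0_FTC2y (fun x => C * expR (- c * x))
   (fun x => - (C / c) * expR (- c * x)) 0.
- by move=> x _; rewrite mulr_ge0// expR_ge0.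
- exact: continuous_expRN_lin.
- rewrite -[X in _ --> X](mulr0 (- (C / c))).
  by apply: cvgMr; exact: expRN_lin_cvg0.
- move=> x; have := is_derive_expRN_lin c x => ?.
  by apply: is_derive_eq; rewrite /GRing.scale /=; field; exact: lt0r_neq0.
by move=> ie ->; rewrite mulr0 expR0 mulr1 sub0r opprK.
Qed.

Lemma exp_bounded_cst_ge0 (f : R -> R) (c C : R) :
  (forall x, 0 <= x -> `|f x| <= C * expR (- c * x)) -> 0 <= C.
Proof.
by move=> /(_ 0 (lexx _)); rewrite mulr0 expR0 mulr1; apply: le_trans.
Qed.

Lemma integrable_exp_bounded (f : R -> R) (c C : R) : 0 < c -> continuous f ->
  (forall x, 0 <= x -> `|f x| <= C * expR (- c * x)) ->
  mu.-integrable `[0, +oo[ (EFin \o f).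
Proof.
move=> c0 cf fC.
have [ie _] := integral_expRN_lin c0 (exp_bounded_cst_ge0 fC).
apply: le_integrable ie => //.
  by apply/measurable_EFinP/measurable_funTS; exact: continuous_measurable_fun.
move=> x /=; rewrite in_itv/= andbT => x0.
by rewrite lee_fin (le_trans (fC _ x0))// ler_norm.
Qed.

(* Adding [C e^(-c x)] to [f] makes it nonnegative on the half-line, where the
   fundamental theorem is available without an integrability hypothesis. *)
Lemma FTC2y_exp_bounded (f F : R -> R) (c C l : R) : 0 < c -> continuous f ->
  (forall x, 0 <= x -> `|f x| <= C * expR (- c * x)) ->
  F x @[x --> +oo] --> l -> (forall x : R, is_derive x 1 F (f x)) ->
  \int[mu]_(x in `[0, +oo[) f x = l - F 0.
Proof.
move=> c0 cf fC Fl dF.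
have [ie Ie] := integral_expRN_lin c0 (exp_bounded_cst_ge0 fC).
have [] := @ge0_FTC2y (fun x => f x + C * expR (- c * x))
  (fun x => F x + - (C / c) * expR (- c * x)) l.
- by move=> x /fC; rewrite ler_norml => /andP[+ _]; lra.
- by move=> x; apply: cvgD; [exact: cf|exact: continuous_expRN_lin].
- rewrite -[X in _ --> X]addr0 -[X in _ + X](mulr0 (- (C / c))).
  by apply: cvgD => //; apply: cvgMr; exact: expRN_lin_cvg0.
- move=> x; have := is_derive_expRN_lin c x => ?; have := dF x => ?.
  by apply: is_derive_eq; rewrite /GRing.scale /=; field; exact: lt0r_neq0.
move=> _; rewrite RintegralD//; last exact: integrable_exp_bounded fC.
by rewrite Ie mulr0 expR0 mulr1; lra.
Qed.

End ExpBounded.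

(** * The weight [e^(-z x^4)]: decay, linearity of [uz] and the Pearson equation *)

Section Weight.
Local Open Scope classical_set_scope.
Variables (R : realType) (z : R).
Hypothesis z_gt0 : 0 < z.
Local Notation mu := (@lebesgue_measure R).
Local Notation w x := (expR (- z * x ^+ 4)).

(** Induction along Horner's scheme [p * 'X + a]: half of the rate [c] goes to [p], and the other
    half absorbs the factor [x], since [1 + y <= e^y] gives [x <= (2 / c) e^(c x / 2)]. *)
Lemma horner_exp_bound (p : {poly R}) (c : R) : 0 < c ->
  exists C, forall x, 0 <= x -> `|p.[x]| <= C * expR (c * x).
Proof.
elim/poly_ind: p c => [|p a IHp] c c0.
  by exists 0 => x _; rewrite horner0 normr0 mul0r.
have [C HC] := IHp (c / 2) (divr_gt0 c0 (ltr0Sn _ _)).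
exists (C * (2 / c) + `|a|) => x x0; rewrite hornerMXaddC.
apply: (le_trans (ler_normD _ _)); rewrite mulrDl lerD//.
  rewrite normrM (ger0_norm x0).
  apply: (@le_trans _ _ (C * expR (c / 2 * x) * (2 / c * expR (c / 2 * x)))).
    apply: ler_pM => //; first exact: HC.
    rewrite -[2 / c]invf_div ler_pdivlMl ?divr_gt0//.
    by apply: le_trans (expR_ge1Dx _); rewrite lerDr.
  rewrite mulrACA -expRD -mulrDl.
  by rewrite (_ : c / 2 + c / 2 = c) //; field.
by rewrite ler_peMr// -expR0 ler_expR mulr_ge0// ltW.
Qed.

Lemma weight_exp_bound (x : R) : w x <= expR z * expR (- z * x).
Proof.
rewrite -expRD ler_expR -subr_ge0.
(* A sum of squares showing that [x^4 - x + 1] is positive. *)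
have -> : z + - z * x - - z * x ^+ 4
    = z * ((x ^+ 2 - 1 / 2) ^+ 2 + (x - 1 / 2) ^+ 2 + 1 / 2).
  by field.
by rewrite mulr_ge0 ?(ltW z_gt0)// !addr_ge0 ?sqr_ge0//.
Qed.

(** The weight decays at rate [z] and the polynomial is allowed growth at rate [z / 2], which leaves
    decay at rate [z / 2]. *)
Lemma horner_weight_exp_bound (p : {poly R}) :
  exists C, forall x, 0 <= x -> `|p.[x] * w x| <= C * expR (- (z / 2) * x).
Proof.
have [C HC] := @horner_exp_bound p (z / 2) (divr_gt0 z_gt0 (ltr0Sn _ _)).
exists (C * expR z) => x x0; rewrite normrM [`|expR _|]gtr0_norm ?expR_gt0//.
apply: (@le_trans _ _ (C * expR (z / 2 * x) * (expR z * expR (- z * x)))).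
  by apply: ler_pM; rewrite ?expR_ge0 ?HC ?weight_exp_bound.
by rewrite mulrACA -expRD (_ : z / 2 * x + - z * x = - (z / 2) * x)//; field.
Qed.

Lemma is_derive_weight (x : R) :
  is_derive x 1 (fun y : R => w y) (- (4 * z * x ^+ 3) * w x).
Proof.
apply: is_derive_eq; rewrite /GRing.scale /=; ring.
Qed.

Lemma is_derive_horner_weight (p : {poly R}) (x : R) :
  is_derive x 1 (fun y : R => p.[y] * w y)
    ((p^`() - (4 * z) *: ('X^3 * p)).[x] * w x).
Proof.
have := is_derive_weight x => ?; have := is_derive_poly p x => ?.
rewrite !(hornerD, hornerN, hornerZ, hornerM, hornerX).
by apply: is_derive_eq; rewrite /GRing.scale /=; ring.
Qed.

Lemma continuous_horner_weight (p : {poly R}) :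
  continuous (fun x : R => p.[x] * w x).
Proof. exact: continuous_is_derive (is_derive_horner_weight p). Qed.

Lemma integrable_horner_weight (p : {poly R}) :
  mu.-integrable `[0, +oo[ (EFin \o (fun x : R => p.[x] * w x)).
Proof.
have [C HC] := horner_weight_exp_bound p.
apply: integrable_exp_bounded HC; last exact: continuous_horner_weight.
by rewrite divr_gt0.
Qed.

Lemma uzD (p q : {poly R}) : uz z (p + q) = uz z p + uz z q.
Proof.
rewrite /uz -RintegralD//; try exact: integrable_horner_weight.
by apply: eq_Rintegral => x _; rewrite hornerD mulrDl.
Qed.

Lemma uzZ (c : R) (p : {poly R}) : uz z (c *: p) = c * uz z p.
Proof.
rewrite /uz -RintegralZl//; last exact: integrable_horner_weight.
by apply: eq_Rintegral => x _; rewrite hornerZ -mulrA.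
Qed.

Lemma horner_weight_cvg0 (p : {poly R}) :
  p.[x] * w x @[x --> +oo] --> (0 : R).
Proof.
have [C HC] := horner_weight_exp_bound p.
have z20 : 0 < z / 2 by rewrite divr_gt0.
have E0 : C * expR (- (z / 2) * x) @[x --> +oo] --> (0 : R).
  by rewrite -[X in _ --> X](mulr0 C); apply: cvgMr; exact: expRN_lin_cvg0.
apply/norm_cvg0P; apply: squeeze_cvgr (cvg_cst 0) E0.
near=> x; rewrite normr_ge0 /=; apply: HC.
by near: x; exact: nbhs_pinfty_ge.
Unshelve. all: by end_near. Qed.

(** Integrate the derivative of [x p(x) e^(-z x^4)]: the factor [x] removes the boundary term at 0,
    and decay removes the one at infinity. *)
Lemma uz_pearson (p : {poly R}) :
  uz z ('X * p^`() + p) = 4 * z * uz z ('X^4 * p).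
Proof.
have [C HC] := horner_weight_exp_bound
  (('X * p)^`() - (4 * z) *: ('X^3 * ('X * p))).
have z20 : 0 < z / 2 by rewrite divr_gt0.
have := FTC2y_exp_bounded z20 (@continuous_horner_weight _) HC
  (horner_weight_cvg0 _) (is_derive_horner_weight _).
rewrite hornerM hornerX !mul0r subr0 -/(uz z _) derivM derivX mul1r.
rewrite -scaleN1r uzD uzZ uzZ mulN1r mulrA -exprSr addrC => /eqP.
by rewrite [_ + p]addrC addrC subr_eq0 => /eqP.
Qed.

End Weight.

(* A formal identity in the two-dimensional space of solutions of the
   recurrence, where [b_2 = b_(-2)], [b_1 = b_(-1)], [a_1 = a_(-1)]. *)
Lemma quartic_expansion (K : comPzRingType)
    (x p0 p1 p2 p3 p4 p5 a_1 a0 a1 a2 a3 a4 b_2 b_1 b0 b1 b2 b3 b4 : K) :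
  let S1 := b1 + b2 in let S2 := b2 + b3 in let S3 := b3 + b4 in
  let R_1 := a0 + b_1 ^+ 2 + a_1 in
  let R0 := a1 + b0 ^+ 2 + a0 in let R1 := a2 + b1 ^+ 2 + a1 in
  let R2 := a3 + b2 ^+ 2 + a2 in let R3 := a4 + b3 ^+ 2 + a3 in
  let T0 := a0 * (b0 + b_1) in let T1 := a1 * (b1 + b0) in
  let T2 := a2 * (b2 + b1) in let T3 := a3 * (b3 + b2) in
  x * p1 = p2 + b1 * p1 + a1 * p0 ->
  x * p2 = p3 + b2 * p2 + a2 * p1 ->
  x * p3 = p4 + b3 * p3 + a3 * p2 ->
  x * p4 = p5 + b4 * p4 + a4 * p3 ->
  x ^+ 4 * p1 =
    (a1 * (T2 + T0) + T1 * (R1 + R0)) * p0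
    + (a1 * (R1 + R_1) + T1 * (b0 + b_1)) * ((x - b0) * p0 - p1)
    + (T1 + a1 * (b_1 + b_2)) * ((x - b_1) * ((x - b0) * p0 - p1) - a0 * p0)
    + a1 * ((x - b_2) * ((x - b_1) * ((x - b0) * p0 - p1) - a0 * p0)
            - a_1 * ((x - b0) * p0 - p1))
    + (a3 * a2 + S1 * T2 + R1 ^+ 2 + T1 * (b0 + b1) + a1 * a0) * p1
    + (T3 + S1 * R2 + R1 * S1 + T1) * p2
    + (R3 + S1 * S2 + R1) * p3
    + (S3 + S1) * p4
    + p5.
Proof.
move=> /= /esym e1 /esym e2 /esym e3 /esym e4.
have -> : p5 = x * p4 - b4 * p4 - a4 * p3 by rewrite -e4; ring.
have -> : p4 = x * p3 - b3 * p3 - a3 * p2 by rewrite -e3; ring.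
have -> : p3 = x * p2 - b2 * p2 - a2 * p1 by rewrite -e2; ring.
have -> : p2 = x * p1 - b1 * p1 - a1 * p0 by rewrite -e1; ring.
ring.
Qed.

(** * Orthogonality, the recurrence and the structure relation *)

Section Orthogonality.
Variables (R : realType) (u : {poly R} -> R) (P : nat -> {poly R}).
Hypothesis uD : forall p q, u (p + q) = u p + u q.
Hypothesis uZ : forall c p, u (c *: p) = c * u p.
Hypothesis hP : monic_orthogonal u P.

(** Monicity of [P k] cancels the coefficient of degree [k]. This is the reduction step of the next
    two inductions. *)
Lemma size_sub_top_coef (q : {poly R}) (k : nat) :
  (size q <= k.+1)%N -> (size (q - (q`_k)%R *: P k)%R <= k)%N.
Proof.
case: hP => szP mP _ _ sq; apply/leq_sizeP => j kj.
rewrite coefB coefZ; move: kj; rewrite leq_eqVlt => /predU1P[<-|kj].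
  have := mP k; rewrite monicE lead_coefE szP /= => /eqP ->.
  by rewrite mulr1 subrr.
rewrite (nth_default _ (leq_trans sq kj)).
by rewrite [X in _ * X]nth_default ?szP// mulr0 subrr.
Qed.

Lemma orthogonal_low_size (q : {poly R}) (m : nat) :
  (size q <= m)%N -> u (q * P m) = 0.
Proof.
case: hP => _ _ oP _.
suff H k : (k <= m)%N -> (size q <= k)%N -> u (q * P m) = 0 by exact: H.
elim: k q => [|k IHk] q km sq.
  move: sq; rewrite leqn0 size_poly_eq0 => /eqP ->.
  by rewrite mul0r -(scale0r 0) uZ mul0r.
rewrite -[q](subrK (q`_k *: P k)) mulrDl uD.
rewrite IHk ?size_sub_top_coef//; last exact: ltnW.
by rewrite -scalerAl uZ oP ?mulr0 ?addr0// neq_ltn km.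
Qed.

(** Pairing with the top [P m] isolates the leading coefficient times [u (P m ^+ 2)], which is
    nonzero; so coefficients vanish one by one from the top. *)
Lemma orthogonal_eq0 (q : {poly R}) (m : nat) : (size q <= m)%N ->
  (forall k, (k < m)%N -> u (q * P k) = 0) -> q = 0.
Proof.
elim: m q => [|m IHm] q sq oq.
  by apply/eqP; rewrite -size_poly_eq0 -leqn0.
have sr := size_sub_top_coef sq.
have qE : q`_m = 0.
  have := oq m (ltnSn m).
  rewrite -{1}[q](subrK (q`_m *: P m)) mulrDl uD orthogonal_low_size// add0r.
  rewrite -scalerAl uZ -expr2 => /eqP; rewrite mulf_eq0.
  by case: hP => _ _ _ /(_ m)/negPf ->; rewrite orbF => /eqP.
apply: IHm => [|k km]; first by move: sr; rewrite qE scale0r subr0.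
by apply: oq; exact: ltnW.
Qed.

Variables a b : int -> R.
Hypothesis hrec : recurrence_coefs P a b.

(** Compute [u (x P_n P_(n+1))] twice: expanding [x P_n] gives [u (P_(n+1)^2)], expanding
    [x P_(n+1)] gives [a_(n+1) u (P_n^2)]. *)
Lemma recurrence_a_neq0 (n : nat) : a n.+1 != 0.
Proof.
have [szP _ oP hn0] := hP; have [_ rec] := hrec.
have h1 : u ('X * P n * P n.+1) = u (P n.+1 ^+ 2).
  rewrite rec !mulrDl !uD -expr2 -!scalerAl !uZ.
  rewrite (oP n) ?neq_ltn ?ltnSn// mulr0 addr0.
  rewrite [X in a _ * X]orthogonal_low_size ?mulr0 ?addr0//.
  by case: n => [|n]; rewrite ?size_poly0 ?szP.
have h2 : u ('X * P n * P n.+1) = a n.+1 * u (P n ^+ 2).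
  rewrite mulrAC rec !mulrDl !uD -!scalerAl !uZ.
  rewrite (oP n.+2) ?neq_ltn ?ltnS ?leqnSn ?orbT//.
  by rewrite (oP n.+1) ?neq_ltn ?ltnSn ?orbT// mulr0 !add0r -expr2.
have := hn0 n.+1; rewrite -h1 h2.
by apply: contraNneq => ->; rewrite mul0r.
Qed.

(* Both sides have the same leading term and the same pairing with every [P k],
   [k <= n]: there the sum in ['X^4 * P n.+1] is orthogonal to [P k]. *)
Lemma structure_relation_of_expansion (t : R) (n : nat) (L : {poly R})
    (g : nat -> R) :
  (forall p, u ('X * p^`() + p) = t * u ('X^4 * p)) ->
  (size L <= n.+1)%N ->
  'X^4 * P n.+1 = L + \sum_(j < 5) g j *: P (n.+1 + j) ->
  'X * (P n.+1)^`() = (n.+1)%:R *: P n.+1 + t *: L.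
Proof.
have [szP _ oP _] := hP => pearson sL XP.
apply/eqP; rewrite -subr_eq0; apply/eqP.
apply: (@orthogonal_eq0 _ n.+1).
  apply/leq_sizeP => j nj; rewrite coefB coefXM coefD !coefZ.
  case: j nj => // j nj; rewrite coef_deriv /=.
  rewrite [L`_ _]nth_default ?(leq_trans sL)// mulr0 addr0.
  rewrite -[_`_ _ *+ _]mulr_natl.
  move: nj; rewrite ltnS leq_eqVlt => /predU1P[<-|nj]; first by rewrite subrr.
  by rewrite [(P _)`_ _]nth_default ?szP// !mulr0 subrr.
move=> k kn.
have XPk : u ('X^4 * (P n.+1 * P k)) = u (L * P k).
  rewrite mulrA XP mulrDl uD mulr_suml.
  have u0 : u 0 = 0 by rewrite -(scale0r 0) uZ mul0r.
  rewrite (big_morph u uD u0) big1 ?addr0// => j _.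
  by rewrite -scalerAl uZ oP ?mulr0// neq_ltn (leq_trans kn) ?orbT ?leq_addr.
have low : u (P n.+1 * ('X * (P k)^`())) = 0.
  rewrite mulrC; apply: orthogonal_low_size; rewrite mulrC.
  (* The derivative vanishes for [k = 0], whereas [size_mulX] concerns nonzero polynomials. *)
  have [->|d0] := eqVneq ((P k)^`()) 0; first by rewrite mul0r size_poly0.
  rewrite size_mulX// (leq_trans (lt_size_deriv _)) ?szP//.
  by rewrite -size_poly_eq0 szP.
(* After the product rule only [u (x P_(n+1)' P_k) = t u (L P_k)] survives, as the other terms
   vanish by orthogonality. *)
have := pearson (P n.+1 * P k).
rewrite XPk derivM mulrDr uD oP ?neq_ltn ?kn ?orbT// addr0 uD.
rewrite [in X in _ + X]mulrCA low addr0.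
rewrite mulrBl mulrDl mulrA => XPd.
rewrite -scaleN1r !uD !uZ -!scalerAl uD !uZ XPd oP ?neq_ltn ?kn ?orbT//.
by rewrite mulr0 add0r mulN1r subrr.
Qed.

Variable z : R.
Hypothesis pearson : forall p, u ('X * p^`() + p) = 4 * z * u ('X^4 * p).
Hypothesis hconv : vanishing_convention a b.

Lemma structure_relation (n : nat) :
  'X * (P n.+1)^`() = Cpoly a b z n * P n - Dpoly a b z n * P n.+1.
Proof.
have [szP _ _ _] := hP; have [_ rec] := hrec; have [a_le0 _] := hconv.
have i1 : n%:Z + 1 = n.+1 :> int by lia.
have i2 : n%:Z + 2 = n.+2 :> int by lia.
have i11 : n.+1%:Z + 1 = n.+2 :> int by lia.
have i1m : n.+1%:Z - 1 = n :> int by lia.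
have i2m : n.+2%:Z - 1 = n.+1 :> int by lia.
have im1 : n%:Z - 1 + 1 = n :> int by lia.
(* [al], [be], [ga] are the brackets of [C_n] and [D_n] without the factor [4 z]. *)
pose al := a n.+1 * (Tcoef a b n.+2 + Tcoef a b n)
           + Tcoef a b n.+1 * (Rcoef a b n.+1 + Rcoef a b n).
pose be := a n.+1 * (Rcoef a b n.+1 + Rcoef a b (n%:Z - 1))
           + Tcoef a b n.+1 * (b n + b (n%:Z - 1)).
pose ga := Tcoef a b n.+1 + a n.+1 * (b (n%:Z - 1) + b (n%:Z - 2)).
pose q1 := if n is m.+1 then P m else 0.
pose q2 := if n is m.+2 then P m else 0.
pose q3 := if n is m.+3 then P m else 0.
(* The recurrence run downwards without division: [L1], [L2], [L3] are [P_(n-1)], [P_(n-2)],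
   [P_(n-3)] multiplied by [a_n], [a_n a_(n-1)], [a_n a_(n-1) a_(n-2)]. *)
pose L1 := ('X - (b n)%:P) * P n - P n.+1.
pose L2 := ('X - (b (n%:Z - 1))%:P) * L1 - (a n)%:P * P n.
pose L3 := ('X - (b (n%:Z - 2))%:P) * L2 - (a (n%:Z - 1))%:P * L1.
(* The prefactors vanish exactly when the downward recurrence would leave the
   range of indices, so the junk value [0] of [q1], [q2], [q3] is harmless. *)
have L1E : L1 = a n *: q1.
  rewrite /L1 mulrBl rec -mul_polyC -/q1; ring.
have L2E : L2 = (a n * a (n%:Z - 1)) *: q2.
  rewrite /L2 L1E /q1 /q2; case: (n) => [|m].
    by rewrite !a_le0// polyC0 !mul0r !scaler0 mulr0 subrr.
  have -> : m.+1%:Z - 1 = m :> int by lia.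
  by rewrite -scalerAr mulrBl rec -scalerA -!mul_polyC; case: m => [|m]; ring.
have L3E : L3 = (a n * a (n%:Z - 1) * a (n%:Z - 2)) *: q3.
  rewrite /L3 L2E L1E /q1 /q2 /q3; case: (n) => [|m].
    by rewrite !scaler0 !mulr0 subrr.
  have -> : m.+1%:Z - 1 = m :> int by lia.
  have -> : m.+1%:Z - 2 = m%:Z - 1 :> int by lia.
  case: m => [|m].
    by rewrite (a_le0 0)// polyC0 mul0r !scaler0 mulr0 subrr.
  have -> : m.+1%:Z - 1 = m :> int by lia.
  rewrite -!scalerAr mulrBl rec -!mul_polyC !polyCM; case: m => [|m]; ring.
pose L := al *: P n + be *: L1 + ga *: L2 + a n.+1 *: L3.
(* The definitions of [L1], [L2], [L3] contain terms of degree up to [n + 3]; the bound is visible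
   only in their forms through [q1], [q2], [q3]. *)
have sL : (size L <= n.+1)%N.
  have sq1 : (size q1 <= n.+1)%N.
    by rewrite /q1; case: (n) => [|m]; rewrite ?size_poly0 ?szP.
  have sq2 : (size q2 <= n.+1)%N.
    by rewrite /q2; case: (n) => [|[|m]]; rewrite ?size_poly0 ?szP//; lia.
  have sq3 : (size q3 <= n.+1)%N.
    by rewrite /q3; case: (n) => [|[|[|m]]]; rewrite ?size_poly0 ?szP//; lia.
  rewrite /L L1E L2E L3E.
  do 3 (apply: (leq_trans (size_polyD _ _)); rewrite geq_max;
    apply/andP; split; last by do ?apply: (leq_trans (size_scale_leq _ _))).
  by apply: (leq_trans (size_scale_leq _ _)); rewrite szP.
pose S k : R := b k + b (k + 1).
(* The components of [x^4 P_(n+1)] along [P_(n+1), ..., P_(n+5)], as in [quartic_expansion]. *)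
pose g := nth 0 [::
  a n.+3 * a n.+2 + S n.+1 * Tcoef a b n.+2 + Rcoef a b n.+1 ^+ 2
    + Tcoef a b n.+1 * (b n + b n.+1) + a n.+1 * a n;
  Tcoef a b n.+3 + S n.+1 * Rcoef a b n.+2 + Rcoef a b n.+1 * S n.+1
    + Tcoef a b n.+1;
  Rcoef a b n.+3 + S n.+1 * S n.+2 + Rcoef a b n.+1;
  S n.+3 + S n.+1; 1].
have i3m : n.+3%:Z - 1 = n.+2 :> int by lia.
have i21 : n.+2%:Z + 1 = n.+3 :> int by lia.
have i31 : n.+3%:Z + 1 = n.+4 :> int by lia.
have XP : 'X^4 * P n.+1 = L + \sum_(j < 5) g j *: P (n.+1 + j).
  have step m : 'X * P m.+1
      = P m.+2 + (b m.+1)%:P * P m.+1 + (a m.+1)%:P * P m.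
    by rewrite rec !mul_polyC.
  (* The four recurrences used start at [P_(n+1)], so small [n] requires no case distinction
     here. *)
  have := quartic_expansion (a (n%:Z - 1))%:P (a n)%:P (b (n%:Z - 2))%:P
    (b (n%:Z - 1))%:P (b n)%:P (step n) (step n.+1) (step n.+2) (step n.+3).
  rewrite !big_ord_recl big_ord0 /L /al /be /ga /g /L3 /L2 /L1 /S.
  rewrite /Rcoef /Tcoef /=.
  rewrite ?(i1, i2, i11, i1m, i2m, im1, i3m, i21, i31) -!mul_polyC.
  rewrite /bump /= !(polyCD, polyCM, polyC1) !addnS addn0 => ->.
  ring.
rewrite (structure_relation_of_expansion pearson sL XP).
rewrite /Cpoly /Dpoly ?(i1, i2, i11, i1m, i2m, im1) -/al -/be -/ga.
rewrite /L /L3 /L2 /L1 -!mul_polyC !(polyCD, polyCN, polyCM) -pmulrn.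
ring.
Qed.

End Orthogonality.

(** * Division by [C_n] and the passage to [P_(n+2)] *)

Lemma Cpoly_neq0 (R : realType) (a b : int -> R) (z : R) (n : int) :
  z != 0 -> a (n + 1) != 0 -> Cpoly a b z n != 0.
Proof.
move=> z0 a0; apply/eqP => /(congr1 (fun p : {poly R} => p`_3)).
rewrite /Cpoly; set c := 4 * z * a (n + 1).
rewrite !(mulrBl, mulrBr, mulrDl, mulrDr).
rewrite !(coefD, coefN, coefZ, coefB, coefXM, coefCM, coefC, coefX) /=.
rewrite !(mulr0, mul0r, subr0, addr0, add0r, mulr1, oppr0) => /eqP.
by rewrite /c !mulf_eq0 (negPf z0) (negPf a0) !orbF pnatr_eq0.
Qed.

(** Solve the structure relation for [p0]. With [al = a_(n+1)] and [y = x - b_(n+1)] the right-hand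
    side is [P_(n+2)] by the recurrence. *)
Lemma lowering_to_raising (K : fieldType) (x al C D p0 p1 dp1 y : K) : C != 0 ->
  x * dp1 = C * p0 - D * p1 ->
  - (al * (x / C) * dp1) - (al * (D / C) - y) * p1 = y * p1 - al * p0.
Proof.
move=> C0 e; have -> : p0 = (x * dp1 + D * p1) / C by rewrite e; field.
by field.
Qed.

Theorem corollary5p4 (R : realType) (z : R) (hz : 0 < z)
    (P : nat -> {poly R}) (a b : int -> R)
    (hP : monic_orthogonal (uz z) P)
    (hrec : recurrence_coefs P a b)
    (hconv : vanishing_convention a b)
    (n : nat) :
  Lhat a b z n (P n.+1) = (P n.+2)%:F.
Proof.
have i1 : n%:Z + 1 = n.+1 :> int by lia.
have C0 : (Cpoly a b z n)%:F != 0.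
  rewrite tofrac_eq0 Cpoly_neq0 ?(lt0r_neq0 hz)// i1.
  exact (recurrence_a_neq0 (uzD hz) (uzZ hz) hP hrec n).
have := structure_relation (uzD hz) (uzZ hz) hP hrec (uz_pearson hz) hconv n.
move=> /(congr1 (@FracField.tofrac _)); rewrite tofracM tofracB !tofracM => sr.
have rec : (P n.+2)%:F = ('X - (b n.+1)%:P)%:F * (P n.+1)%:F
    - (a n.+1)%:P%:F * (P n)%:F.
  rewrite -!tofracM -tofracB mulrBl hrec.2 -!mul_polyC; congr (_%:F).
  ring.
rewrite rec /Lhat /Afrac /Bfrac i1.
exact: lowering_to_raising.
Qed.
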